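(* There is an absolute constant $c>0$ with the following property. For every sufficiently small $\varepsilon>0$ and every sufficiently large $n$, there exists a forest $H$ on $n$ vertices with maximum degree bounded by an absolute constant such that any property tester for the property $\{H\}$ with proximity parameter $\varepsilon$ makes at least $\exp(c\,\varepsilon^{-1})$ queries.
   Context: Bounded-degree graph model: the input is a graph $G$ with vertex set $[n]$ and maximum degree at most $d$. It is accessed through neighbor queries: given $v$ and $i\in[d]$, the oracle returns the $i$-th neighbor of $v$, or $\bot$ if there is none. The distance of $G$ to $\{H\}$ is the minimum number of edge additions and removals making $G$ isomorphic to $H$, divided by $dn$. $G$ is $\varepsilon$-far if this distance exceeds $\varepsilon$. A property tester with proximity parameter $\varepsilon$ is a randomized query algorithm with two guarantees. It accepts with probability at least $2/3$ if $G\cong H$. It rejects with probability at least $2/3$ if $G$ is $\varepsilon$-far from $\{H\}$. *)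

(* Defs.v *)
From mathcomp Require Import all_boot all_order all_algebra perm.
From mathcomp Require Import all_classical all_reals all_analysis.

Set Implicit Arguments.
Unset Strict Implicit.
Unset Printing Implicit Defensive.

Import Order.TTheory GRing.Theory Num.Theory.

Local Open Scope nat_scope.

Definition simple_graph n (e : rel 'I_n) : Prop := symmetric e /\ irreflexive e.

Definition max_degree n (e : rel 'I_n) : nat :=
  \max_(v < n) #|[set w | e v w]|.

(* The size bound excludes the closed walk u, v, u along a single edge. *)
Definition forest n (e : rel 'I_n) : Prop :=
  simple_graph e /\ forall s : seq 'I_n, 2 < size s -> ~ ucycle e s.

Definition relabel n (s : {perm 'I_n}) (e : rel 'I_n) : rel 'I_n :=
  fun u v => e (s u) (s v).

Definition isomorphic n (g h : rel 'I_n) : Prop :=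
  exists s : {perm 'I_n}, g =2 relabel s h.

Definition edges n (e : rel 'I_n) : {set {set 'I_n}} :=
  [set [set p.1; p.2] | p : 'I_n * 'I_n & e p.1 p.2].

(* Edge removals plus edge additions turning g into g'. *)
Definition edits n (g g' : rel 'I_n) : nat :=
  #|edges g :\: edges g'| + #|edges g' :\: edges g|.

(* The copies of h on the vertex set 'I_n are exactly its relabellings. *)
Definition edits_to_iso n (g h : rel 'I_n) : nat :=
  edits g (relabel [arg min_(s < (1%g : {perm 'I_n})) edits g (relabel s h)] h).

Definition distance (R : realType) d n (g h : rel 'I_n) : R :=
  ((edits_to_iso g h)%:R / (d%:R * n%:R))%R.

Definition far (R : realType) d n (eps : R) (g h : rel 'I_n) : Prop :=
  (eps < distance R d g h)%R.

(* The neighbours of each vertex are listed in an arbitrary order, which is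
   part of the input. *)
Definition adjacency_lists n (g : rel 'I_n) (L : 'I_n -> seq 'I_n) : Prop :=
  forall v, uniq (L v) /\ L v =i [set w | g v w].

Definition is_input d n (g : rel 'I_n) (L : 'I_n -> seq 'I_n) : Prop :=
  [/\ simple_graph g, max_degree g <= d & adjacency_lists g L].

(* Deterministic adaptive query algorithms, as decision trees; the output
   [true] means acceptance. Neighbours are numbered from 0, and [None] answers
   a query for a neighbour that does not exist. *)
Inductive query_algorithm (n d : nat) : Type :=
| Output of bool
| Query of 'I_n & 'I_d & (option 'I_n -> query_algorithm n d).

Fixpoint accepts n d (L : 'I_n -> seq 'I_n) (t : query_algorithm n d) : bool :=
  match t with
  | Output b => b
  | Query v i k => accepts L (k (onth (L v) i))
  end.

Fixpoint queries n d (L : 'I_n -> seq 'I_n) (t : query_algorithm n d) : nat :=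
  match t with
  | Output _ => 0
  | Query v i k => (queries L (k (onth (L v) i))).+1
  end.

(* A randomized algorithm is a deterministic one [A w] chosen according to a
   random seed [w] drawn from an arbitrary probability space. *)
Definition accept_event n d (Omega : Type) (A : Omega -> query_algorithm n d)
    (L : 'I_n -> seq 'I_n) : set Omega :=
  [set w | accepts L (A w)]%classic.

Definition property_tester (R : realType) d n (h : rel 'I_n) (eps : R)
    (disp : measure_display) (Omega : measurableType disp)
    (P : probability Omega R) (A : Omega -> query_algorithm n d) : Prop :=
  forall (g : rel 'I_n) (L : 'I_n -> seq 'I_n), is_input d g L ->
    [/\ measurable (accept_event A L),
        isomorphic g h -> ((2 / 3)%:E <= P (accept_event A L))%E
      & far d eps g h -> ((2 / 3)%:E <= P (~` accept_event A L)%classic)%E].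

(* Main.v *)
(* Let H contain equally many copies of each of the N = 2^(l+1) trees of a
   family of pairwise incomparable caterpillars with O(l) vertices. A graph
   containing twice as many copies of each tree of a random half of the family
   is far from H: each of the n / O(l) copies in H of an absent tree must use an
   added edge. Both inputs assign tree types to vertex blocks, and are randomized
   by permuting the blocks and the types. Until two queried blocks carry the same
   type, the types found are uniform among the unseen ones in both cases, so
   distinguishing them takes of the order of sqrt N = exp(c l) queries, where l
   is of the order of 1 / eps. *)

Require Import Defs.
From mathcomp Require Import all_boot all_order all_algebra perm.
From mathcomp Require Import all_classical all_reals all_analysis.
From mathcomp Require Import measurable_realfun zify ring lra.

Set Implicit Arguments.
Unset Strict Implicit.
Unset Printing Implicit Defensive.

Import Order.TTheory GRing.Theory Num.Theory.

Local Open Scope ring_scope.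

(** * Extensions of partial assignments in exchangeable families *)

Section ExchangeableFamilies.

Variables B T : finType.
Implicit Types (D : seq (B * T)) (f : {ffun B -> T}) (F : {set {ffun B -> T}}).

(** [D] serves as a transcript: the blocks queried so far, each with the type found there. *)
Definition extends D f : bool := all (fun p => f p.1 == p.2) D.

Definition extensions F D : {set {ffun B -> T}} := [set f in F | extends D f].

Definition exchangeable F : Prop :=
  forall (s : {perm T}) (p : {perm B}) f, f \in F -> [ffun b => s (f (p b))] \in F.

Definition fibers_bounded (k : nat) F : Prop :=
  forall f, f \in F -> forall a, (#|[set b | f b == a]| <= k)%N.

Lemma extensions_nil F : extensions F [::] = F.
Proof. by apply/setP => f; rewrite inE andbT. Qed.

Lemma extensions_cons F D b a :
  extensions F ((b, a) :: D) = [set f in extensions F D | f b == a].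
Proof. by apply/setP => f; rewrite !inE /= andbA andbAC. Qed.

(** Exchanging the values [a] and [a'] preserves [F] and, as neither occurs in [D], all constraints
    of [D]. Hence unseen types are equally likely. *)
Lemma card_extensions_value_le F D b a a' : exchangeable F ->
  a \notin unzip2 D -> a' \notin unzip2 D ->
  (#|extensions F ((b, a) :: D)| <= #|extensions F ((b, a') :: D)|)%N.
Proof.
move=> Fex aD a'D; pose t f : {ffun B -> T} := [ffun x => tperm a a' (f x)].
have t_inj : injective t.
  move=> f g /ffunP fg; apply/ffunP => x; have := fg x.
  by rewrite !ffunE => /perm_inj.
rewrite -(card_imset _ t_inj); apply: subset_leq_card; apply/fintype.subsetP => _ /imsetP[f + ->].
rewrite !inE /= => /and3P[fF /eqP fb /allP fD]; rewrite /t.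
apply/and3P; split.
- rewrite (_ : [ffun x => _] = [ffun x => tperm a a' (f ((1%g : {perm B}) x))]) ?Fex //.
  by apply/ffunP => x; rewrite !ffunE perm1.
- by rewrite ffunE fb tpermL.
- apply/allP => -[x c] xcD /=; rewrite ffunE (eqP (fD _ xcD)) /=.
  have cD : c \in unzip2 D by apply/mapP; exists (x, c).
  by rewrite tpermD //; [apply: contraNneq aD => -> | apply: contraNneq a'D => ->].
Qed.

Lemma card_extensions_value F D b a a' : exchangeable F ->
  a \notin unzip2 D -> a' \notin unzip2 D ->
  #|extensions F ((b, a) :: D)| = #|extensions F ((b, a') :: D)|.
Proof.
by move=> Fex aD a'D; apply/eqP; rewrite eqn_leq !card_extensions_value_le.
Qed.

Lemma card_extensions_point_le F D b b' a : exchangeable F ->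
  b \notin unzip1 D -> b' \notin unzip1 D ->
  (#|extensions F ((b, a) :: D)| <= #|extensions F ((b', a) :: D)|)%N.
Proof.
move=> Fex bD b'D; pose t f : {ffun B -> T} := [ffun x => f (tperm b b' x)].
have t_inj : injective t.
  move=> f g /ffunP fg; apply/ffunP => x; have := fg (tperm b b' x).
  by rewrite !ffunE tpermK.
rewrite -(card_imset _ t_inj); apply: subset_leq_card; apply/fintype.subsetP => _ /imsetP[f + ->].
rewrite !inE /= => /and3P[fF /eqP fb /allP fD]; rewrite /t.
apply/and3P; split.
- rewrite (_ : [ffun x => _] = [ffun x => (1%g : {perm T}) (f (tperm b b' x))]) ?Fex //.
  by apply/ffunP => x; rewrite !ffunE perm1.
- by rewrite ffunE tpermR fb.
- apply/allP => -[x c] xcD /=; rewrite ffunE.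
  have xD : x \in unzip1 D by apply/mapP; exists (x, c).
  rewrite tpermD ?(eqP (fD _ xcD)) //.
    by apply: contraNneq bD => ->.
  by apply: contraNneq b'D => ->.
Qed.

Lemma card_extensions_point F D b b' a : exchangeable F ->
  b \notin unzip1 D -> b' \notin unzip1 D ->
  #|extensions F ((b, a) :: D)| = #|extensions F ((b', a) :: D)|.
Proof.
by move=> Fex bD b'D; apply/eqP; rewrite eqn_leq !card_extensions_point_le.
Qed.

Lemma card_extensionsE F D b a :
  #|extensions F ((b, a) :: D)| = (\sum_(f in extensions F D) (f b == a))%N.
Proof.
by rewrite extensions_cons -sum1dep_card big_mkcondr /=; apply: eq_bigr => f _; case: eqP.
Qed.

Lemma card_extensions_sum F D b :
  #|extensions F D| = (\sum_a #|extensions F ((b, a) :: D)|)%N.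
Proof.
under eq_bigr => a _ do rewrite card_extensionsE.
rewrite exchange_big /= -sum1_card; apply: eq_bigr => f _.
by rewrite (bigD1 (f b)) //= eqxx big1 // => a; rewrite eq_sym => /negbTE ->.
Qed.

Lemma card_fresh (X : finType) (s : seq X) : uniq s -> #|[pred x | x \notin s]| = (#|X| - size s)%N.
Proof. by move=> /card_uniqP <-; rewrite -(cardC (mem s)) addKn; apply: eq_card. Qed.

(** Double counting: the number of extensions is the same for every point outside [D], and the sum
    over these points counts each [f] at most as often as its fiber over [a] has elements. *)
Lemma collision_bound F D b a k : exchangeable F -> fibers_bounded k F ->
  b \notin unzip1 D -> uniq (unzip1 D) ->
  (#|extensions F ((b, a) :: D)| * (#|B| - size D) <= k * #|extensions F D|)%N.
Proof.
move=> Fex Fk bD uD; rewrite mulnC -(size_map fst) -card_fresh // -sum_nat_const.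
rewrite (eq_bigr (fun b' => \sum_(f in extensions F D) (f b' == a))%N); last first.
  by move=> b' b'D; rewrite -card_extensionsE; apply: card_extensions_point.
rewrite exchange_big /= mulnC -sum_nat_const; apply: leq_sum => f; rewrite inE => /andP[fF _].
apply: leq_trans (Fk f fF a); rewrite -sum1dep_card [leqRHS]big_mkcond [leqLHS]big_mkcond /=.
by apply: leq_sum => x _; case: ifP => // _; case: eqP.
Qed.

(** By [collision_bound], the types already in [D] take at most a share [e] of the extensions; the
    unseen types split the rest equally. *)
Lemma extensions_step F D b a k (R : realFieldType) (e : R) q :
  exchangeable F -> fibers_bounded k F ->
  uniq (unzip1 D) -> uniq (unzip2 D) ->
  b \notin unzip1 D -> a \notin unzip2 D ->
  (size D <= q)%N -> (q < #|B|)%N ->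
  (q * k)%:R <= e * (#|B| - q)%:R ->
  (1 - e) * #|extensions F D|%:R <= (#|T| - size D)%:R * #|extensions F ((b, a) :: D)|%:R.
Proof.
move=> Fex Fk u1 u2 bD aD Dq qB qk.
set x := (#|extensions F D|)%:R; set y := (#|extensions F ((b, a) :: D)|)%:R.
have Bq0 : 0 < (#|B| - q)%:R :> R by rewrite ltr0n subn_gt0.
have e0 : 0 <= e.
  by move: (le_trans (ler0n R _) qk); rewrite pmulr_lge0.
pose coll := (\sum_(c in unzip2 D) #|extensions F ((b, c) :: D)|)%N.
have split_x : #|extensions F D| = (coll + (#|T| - size D) * #|extensions F ((b, a) :: D)|)%N.
  rewrite (card_extensions_sum F D b) (bigID (mem (unzip2 D))) /=; congr addn.
  rewrite (eq_bigr (fun _ => #|extensions F ((b, a) :: D)|)); last first.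
    by move=> c cD; apply: card_extensions_value.
  by rewrite sum_nat_const card_fresh // size_map.
have coll_le : (coll * (#|B| - q) <= q * k * #|extensions F D|)%N.
  rewrite big_distrl /=.
  apply: (@leq_trans (\sum_(c in unzip2 D) k * #|extensions F D|)%N).
    apply: leq_sum => c _; apply: leq_trans (collision_bound c Fex Fk bD u1).
    by rewrite leq_mul2l leq_sub2l ?orbT.
  by rewrite sum_nat_const (card_uniqP u2) size_map mulnA !leq_mul.
have : coll%:R <= e * x.
  rewrite -(ler_pM2r Bq0) -natrM (le_trans (y := (q * k * #|extensions F D|)%:R)) ?ler_nat //.
  by rewrite natrM mulrAC ler_wpM2r // ler0n.
have -> : (#|T| - size D)%:R * y = x - coll%:R :> R.
  by rewrite /x split_x natrD addrAC subrr add0r natrM.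
by lra.
Qed.

(** The resulting lower bound on the probability of a transcript without repetitions is the same for
    all such families, which is what makes two of them hard to tell apart. *)
Lemma extensions_lower F D k (R : realFieldType) (e : R) q :
  exchangeable F -> fibers_bounded k F ->
  uniq (unzip1 D) -> uniq (unzip2 D) ->
  (size D <= q)%N -> (q < #|B|)%N ->
  (q * k)%:R <= e * (#|B| - q)%:R -> e <= 1 ->
  (1 - e) ^+ size D * #|F|%:R <= (#|T| ^_ size D)%:R * #|extensions F D|%:R.
Proof.
move=> Fex Fk + + + qB qk e1; elim: D => [|[b a] D IH] /=.
  by move=> _ _ _; rewrite ffactn0 expr0 !mul1r extensions_nil.
move=> /andP[bD u1] /andP[aD u2] Dq.
have := extensions_step Fex Fk u1 u2 bD aD (ltnW Dq) qB qk.
have := IH u1 u2 (ltnW Dq); move: (size D) => r IHr step.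
rewrite exprS ffactnSr natrM -!mulrA.
apply: le_trans (ler_wpM2l _ IHr) _; first by rewrite subr_ge0.
by rewrite mulrCA ler_wpM2l.
Qed.

End ExchangeableFamilies.

(** * Distinguishing two exchangeable families by queries *)

Section QueryLowerBound.

Variables (B T : finType) (n d : nat).
Variables (L : {ffun B -> T} -> 'I_n -> seq 'I_n) (blk : 'I_n -> B).
Hypothesis L_local : forall v (f f' : {ffun B -> T}), f (blk v) = f' (blk v) -> L f v = L f' v.
Variables (Y Z : {set {ffun B -> T}}) (k q : nat) (R : realFieldType) (e : R).
Hypotheses (Y_exchangeable : exchangeable Y) (Z_exchangeable : exchangeable Z).
Hypotheses (Y_fibers : fibers_bounded k Y) (Z_fibers : fibers_bounded k Z).
Hypotheses (Y_gt0 : (0 < #|Y|)%N) (Z_gt0 : (0 < #|Z|)%N).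
Hypotheses (q_lt_B : (q < #|B|)%N) (q_lt_T : (q < #|T|)%N).
Hypotheses (e_ge0 : 0 <= e) (e_lt1 : e < 1) (qk_le : (q * k)%:R <= e * (#|B| - q)%:R).
Implicit Types (t : query_algorithm n d) (D : seq (B * T)) (F : {set {ffun B -> T}}).

(** The sum of the two error rates when [Y] should be accepted and [Z] rejected, restricted to
    inputs consistent with [D]. Dividing by the full families makes it additive under refinement of
    [D]. *)
Definition error t D : R :=
  #|[set f in extensions Y D | ~~ accepts (L f) t]|%:R / #|Y|%:R
  + #|[set f in extensions Z D | accepts (L f) t]|%:R / #|Z|%:R.

Lemma card_extensions_split F D b (P : pred {ffun B -> T}) (Q : T -> pred {ffun B -> T}) :
  (forall f, P f = Q (f b) f) ->
  #|[set f in extensions F D | P f]| =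
  (\sum_a #|[set f in extensions F ((b, a) :: D) | Q a f]|)%N.
Proof.
move=> PQ.
rewrite (eq_bigr (fun a => \sum_(f in [set f in extensions F D | P f]) (f b == a))%N).
  rewrite exchange_big /= -sum1_card; apply: eq_bigr => f _.
  by rewrite (bigD1 (f b)) //= eqxx big1 // => a; rewrite eq_sym => /negbTE ->.
move=> a _; rewrite extensions_cons -sum1dep_card [RHS]big_mkcond [LHS]big_mkcond /=.
rewrite [RHS]big_mkcond.
by apply: eq_bigr => f _; rewrite !inE PQ; case: eqP => [->|]; rewrite ?andbF ?andbT //=; case: ifP.
Qed.

Lemma extensions_lower_ratio F D : exchangeable F -> fibers_bounded k F -> (0 < #|F|)%N ->
  uniq (unzip1 D) -> uniq (unzip2 D) -> (size D <= q)%N ->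
  (1 - e) ^+ q / (#|T| ^_ size D)%:R <= #|extensions F D|%:R / #|F|%:R.
Proof.
move=> Fex Fk F0 u1 u2 Dq.
have := extensions_lower Fex Fk u1 u2 Dq q_lt_B qk_le (ltW e_lt1).
rewrite ler_pdivrMr ?ltr0n ?ffact_gt0 ?(leq_trans Dq (ltnW q_lt_T)) //.
rewrite mulrAC ler_pdivlMr ?ltr0n // [X in _ <= X -> _]mulrC; apply: le_trans.
rewrite ler_wpM2r // ler_wiXn2l //; first by rewrite subr_ge0 ltW.
by rewrite gerBl.
Qed.

(* The bound passes from the children of a query to a fresh block to the query
   itself: the new type ranges over [#|T| - size D] unseen values, which is the
   ratio of consecutive falling factorials. *)
Lemma error_lower t D :
  uniq (unzip1 D) -> uniq (unzip2 D) -> (size D <= q)%N ->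
  (forall f, extends D f -> (queries (L f) t + size D <= q)%N) ->
  (1 - e) ^+ q / (#|T| ^_ size D)%:R <= error t D.
Proof.
elim: t D => [out|v i c IH] D u1 u2 Dq Hq.
  (* A constant answer is wrong on every consistent input of one family, and that term alone meets
     the bound. *)
  rewrite /error /=; case: out Hq => /= _.
    have -> : [set f in extensions Z D | true] = extensions Z D.
      by apply/setP => f; rewrite inE andbT.
    by rewrite ler_wpDl ?extensions_lower_ratio // divr_ge0.
  have -> : [set f in extensions Y D | true] = extensions Y D.
    by apply/setP => f; rewrite inE andbT.
  by rewrite ler_wpDr ?extensions_lower_ratio // divr_ge0.
pose ans a := onth (L [ffun => a] v) i.
have ansE f : onth (L f v) i = ans (f (blk v)).
  by rewrite /ans (@L_local v f [ffun => f (blk v)]) // ffunE.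
(* The positive lower bound provides a member of [Y] extending [D]; on it the present query still
   has to be counted, hence the strict inequality. *)
have Dq1 : (size D < q)%N.
  have : 0 < (1 - e) ^+ q / (#|T| ^_ size D)%:R.
    rewrite divr_gt0 ?exprn_gt0 ?subr_gt0 // ltr0n ffact_gt0.
    exact: leq_trans Dq (ltnW q_lt_T).
  move=> /lt_le_trans /(_ (extensions_lower_ratio Y_exchangeable Y_fibers Y_gt0 u1 u2 Dq)).
  rewrite pmulr_lgt0 ?invr_gt0 ?ltr0n // card_gt0 => /set0Pn[f].
  by rewrite inE => /andP[_ /Hq] /=; lia.
(* In a block met before, the answer is determined by [D]: one branch remains and the transcript
   does not grow. *)
have [bD|bD] := boolP (blk v \in unzip1 D).
  have /mapP[[b a] baD /= bE] := bD.
  have fE f : extends D f -> f (blk v) = a.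
    by move=> /allP /(_ _ baD) /eqP /=; rewrite -bE.
  rewrite (_ : error _ _ = error (c (ans a)) D); last first.
    rewrite /error; congr (_ + _); congr (_ / _); congr (_ *+ _); apply: eq_card => f;
      rewrite !inE /= ansE; by case: (boolP (extends D f)) => [/fE ->|]; rewrite ?andbF.
  apply: IH => // f fD; have := Hq f fD; rewrite /= ansE fE //; lia.
rewrite (_ : error _ _ = \sum_a error (c (ans a)) ((blk v, a) :: D)); last first.
  rewrite big_split /= -!mulr_suml -!natr_sum; congr (_ + _);
    congr (_ / _); congr (_ *+ _).
    by apply: card_extensions_split => f /=; rewrite ansE.
  by apply: card_extensions_split => f /=; rewrite ansE.
(* Branches in which the new block repeats a seen type are discarded, their errors being
   nonnegative. *)
rewrite (bigID (mem (unzip2 D))) /= ler_wpDl //.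
  by apply: sumr_ge0 => a _; rewrite addr_ge0 // divr_ge0.
have IHa a : a \notin unzip2 D ->
    (1 - e) ^+ q / (#|T| ^_ (size D).+1)%:R <= error (c (ans a)) ((blk v, a) :: D).
  move=> aD; apply: (IH (ans a) ((blk v, a) :: D)) => //=; rewrite ?bD ?aD //.
  move=> f /andP[/eqP fb fD]; have := Hq f fD; rewrite /= ansE fb; lia.
apply: le_trans (ler_sum _ IHa).
rewrite sumr_const card_fresh // size_map -[leRHS]mulr_natr ffactnSr natrM invfM -!mulrA.
rewrite ler_wpM2l ?exprn_ge0 ?subr_ge0 ?(ltW e_lt1) //.
rewrite mulVf ?mulr1 // pnatr_eq0 subn_eq0 -ltnNge.
exact: ltn_trans Dq1 q_lt_T.
Qed.

End QueryLowerBound.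

(** * Averaging over the random seed of the tester *)

Lemma le_weighted_probability (R : realType) (disp : measure_display)
    (Omega : measurableType disp) (P : probability Omega R) (I : finType)
    (c : I -> R) (A : I -> set Omega) (delta : R) :
  0 <= delta -> (forall i, 0 <= c i) -> (forall i, measurable (A i)) ->
  (forall w, delta <= \sum_i c i * \1_(A i) w) ->
  delta <= \sum_i c i * fine (P (A i)).
Proof.
move=> delta0 c0 mA le_delta.
have PA i : P (A i) = (fine (P (A i)))%:E by rewrite fineK // fin_num_measure.
rewrite -lee_fin -(mule1 delta%:E) -(@probability_setT _ _ _ P) -integral_cst //.
apply: (@le_trans _ _ (\int[P]_w (\sum_i (c i * \1_(A i) w)%:E))%E).
  apply: ge0_le_integral => //=.
  - by apply: emeasurable_sum => i; apply/measurable_EFinP/measurable_funM.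
  - by move=> w _; rewrite sumEFin lee_fin.
rewrite ge0_integral_sum //=; last 2 first.
- by move=> i; apply/measurable_EFinP/measurable_funM.
- by move=> i w _; rewrite lee_fin mulr_ge0.
rewrite -sumEFin; apply: lee_sum => i _.
under eq_integral => w _ do rewrite EFinM.
rewrite ge0_integralZl_EFin //=; last first.
  by apply/measurable_EFinP.
by rewrite integral_indic // setIT EFinM -PA.
Qed.

(** The easy direction of Yao's principle: a lower bound on the total error that holds for each seed
    survives averaging over the seeds, and after averaging each of the two error rates is at most
    1/3. *)
Lemma average_error_le (R : realType) (disp : measure_display)
    (Omega : measurableType disp) (P : probability Omega R) (X : finType)
    (acc : Omega -> X -> bool) (Y Z : {set X}) (delta : R) :
  0 <= delta -> (0 < #|Y|)%N -> (0 < #|Z|)%N ->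
  (forall x, measurable [set w | acc w x]%classic) ->
  (forall x, x \in Y -> ((2 / 3)%:E <= P [set w | acc w x]%classic)%E) ->
  (forall x, x \in Z -> ((2 / 3)%:E <= P (~` [set w | acc w x])%classic)%E) ->
  (forall w, delta <= #|[set x in Y | ~~ acc w x]|%:R / #|Y|%:R
                      + #|[set x in Z | acc w x]|%:R / #|Z|%:R) ->
  delta <= 2 / 3.
Proof.
move=> delta0 Y0 Z0 mE PY PZ le_delta.
pose c (W : {set X}) x : R := if x \in W then #|W|%:R^-1 else 0.
have c0 W x : 0 <= c W x by rewrite /c; case: ifP.
pose E x : set Omega := [set w | acc w x]%classic.
(* [inl x] indexes the wrong rejection of [x] from [Y], [inr x] the wrong acceptance of [x] from
   [Z]. *)
pose A (i : X + X) := match i with inl x => (~` E x)%classic | inr x => E x end.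
pose cc (i : X + X) := match i with inl x => c Y x | inr x => c Z x end.
have PE x : P (E x) = (fine (P (E x)))%:E by rewrite fineK // fin_num_measure //; apply: mE.
have PEC x : P (~` E x)%classic = (1 - fine (P (E x)))%:E.
  by rewrite probability_setC; [rewrite EFinB -PE | apply: mE].
have /le_trans : delta <= \sum_i cc i * fine (P (A i)).
  apply: le_weighted_probability => //.
  - by case=> x; apply: c0.
  - by case=> x /=; [apply: measurableC|]; apply: mE.
  - move=> w; apply: le_trans (le_delta w) _.
    rewrite big_sumType /=; apply: lerD.
      rewrite -sum1_card natr_sum mulr_suml big_mkcond /= ler_sum // => x _.
      rewrite inE /c; case: ifP => /= [/andP[-> nacc]|]; last by case: ifP.
      rewrite indicE mul1r (_ : w \in _ = true) ?mulr1 //.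
      by apply/mem_set => /=; apply/negP.
    rewrite -sum1_card natr_sum mulr_suml big_mkcond /= ler_sum // => x _.
    rewrite inE /c; case: ifP => /= [/andP[-> accx]|]; last by case: ifP.
    rewrite indicE mul1r (_ : w \in _ = true) ?mulr1 //.
    by apply/mem_set.
apply; rewrite big_sumType /= (_ : 2 / 3 = 1 / 3 + 1 / 3 :> R); last by lra.
have csum (W : {set X}) p : (0 < #|W|)%N -> (forall x, x \in W -> p x <= 1 / 3) ->
    \sum_x c W x * p x <= 1 / 3.
  move=> W0 pW; have W0' : 0 < #|W|%:R :> R by rewrite ltr0n.
  rewrite (_ : 1 / 3 = \sum_x c W x * (1 / 3)); last first.
    have -> : \sum_x c W x * (1 / 3) = (#|W|%:R^-1 * #|W|%:R) * (1 / 3).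
      by rewrite -mulr_suml mulr_natr -sumr_const [in RHS]big_mkcond.
    by rewrite mulVf ?mul1r ?gt_eqF.
  apply: ler_sum => x _; rewrite /c; case: ifP => xW; last by rewrite !mul0r.
  by rewrite ler_wpM2l ?invr_ge0 ?ler0n ?pW.
apply: lerD; apply: csum => // x xW.
  by rewrite PEC /=; have := PY x xW; rewrite PE lee_fin; lra.
by have := PZ x xW; rewrite PEC lee_fin; lra.
Qed.

(** * Caterpillar forests *)

(** The largest vertex of a cycle would have two distinct smaller neighbors, its predecessor and its
    successor. *)
Lemma forest_of_unique_smaller_neighbor n (e : rel 'I_n) (p : nat -> nat) :
  simple_graph e -> (forall u v : 'I_n, e u v -> (u < v)%N -> u = p v :> nat) -> forest e.
Proof.
move=> [e_sym e_irr] ep; split=> // s s_gt2 /andP[s_cyc s_uniq].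
have [x0 x0s] : exists x, x \in s.
  by case: s s_gt2 {s_cyc s_uniq} => // x s _; exists x; rewrite mem_head.
case: (@arg_maxnP _ x0 (mem s) (@nat_of_ord n) x0s) => x /= xs x_max.
have [i s' rot_s] := rot_to xs.
move: s_cyc s_uniq s_gt2; rewrite -(rot_cycle i) -(rot_uniq i) -(size_rot i s) rot_s.
have x_max' y : y \in x :: s' -> (y <= x)%N by rewrite -rot_s mem_rot => /x_max.
case/lastP: s' {rot_s} x_max' => [|s' z] // x_max'; case: s' x_max' => [|y s'] // x_max'.
rewrite /= rcons_path => /andP[exy /andP[_ +]] /and3P[xs' ys' _] _.
rewrite last_rcons => ezx.
have lt_x w : w \in y :: rcons s' z -> (w < x)%N.
  move=> ws; rewrite ltn_neqAle; apply/andP; split; last by rewrite x_max' // in_cons ws orbT.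
  by apply: contraNneq xs' => /val_inj <-.
have zs : z \in y :: rcons s' z by rewrite in_cons mem_rcons mem_head orbT.
have ys : y \in y :: rcons s' z by rewrite mem_head.
have := ep _ _ ezx (lt_x _ zs); rewrite e_sym in exy.
rewrite -(ep _ _ exy (lt_x _ ys)) => /val_inj zy.
by move: ys'; rewrite -zy mem_rcons mem_head.
Qed.

Section BlockForests.

Variables (J : nat) (B : finType) (b0 : B).
Hypothesis J_gt2 : (2 < J)%N.

Implicit Types (w : B -> nat -> bool) (v x y : nat).

(* Each block consists of J cells of four vertices: cell j holds spine vertex 4j,
   joined to spine vertex 4(j-1), and the candidate leaves 4j+1, 4j+2, 4j+3. In
   cell 0 all three leaves are attached, making the root the only vertex of
   degree four; in cell j > 0 the first leaf is attached iff [w b j]. *)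
Definition blk v : B := nth b0 (enum B) (v %/ 4 %/ J).

Definition cell (b : B) j : nat := (index b (enum B) * J + j)%N.

Definition in_blocks v : bool := (v %/ 4 < #|B| * J)%N.

(** At the first spine vertex of a block the value has no meaning; [attached] is false there. *)
Definition parent v : nat := if (v %% 4 == 0)%N then (v - 4)%N else (v - v %% 4)%N.

(** Presence of the edge from [v] to its parent. Vertices beyond the blocks stay isolated and absorb
    the remainder of [n]. *)
Definition attached w v : bool :=
  in_blocks v &&
  if (v %% 4 == 0)%N then (v %/ 4 %% J != 0)%N
  else (v %/ 4 %% J == 0)%N || (v %% 4 == 1)%N && w (blk v) (v %/ 4 %% J)%N.

Definition adj w x y : bool :=
  attached w y && (parent y == x) || attached w x && (parent x == y).

Definition block_graph n w : rel 'I_n := fun (u v : 'I_n) => adj w u v.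

Lemma adjC w x y : adj w x y = adj w y x.
Proof. by rewrite /adj orbC. Qed.

Lemma parent_lt w y : attached w y -> (parent y < y)%N.
Proof.
rewrite /attached /parent => /andP[_]; case: ifP => [y4|y4 _]; last by lia.
move=> H; suff : (0 < y %/ 4)%N by lia.
by case: (y %/ 4)%N H => //; rewrite mod0n.
Qed.

Lemma blk_cell b j r : (j < J)%N -> (r < 4)%N -> blk (4 * cell b j + r) = b.
Proof.
move=> jJ r4; rewrite /blk /cell.
rewrite (_ : (4 * (_ * J + j) + r) %/ 4 = index b (enum B) * J + j)%N; last by lia.
have J_gt0 : (0 < J)%N by lia.
by rewrite divnMDl // (divn_small jJ) addn0 nth_index // mem_enum.
Qed.

Lemma cell_mod b j : (j < J)%N -> (cell b j %% J = j)%N.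
Proof. by move=> jJ; rewrite /cell modnMDl modn_small. Qed.

Lemma cell_lt b j : (j < J)%N -> (cell b j < #|B| * J)%N.
Proof.
move=> jJ; apply: (@leq_trans ((index b (enum B)).+1 * J)).
  by rewrite mulSn /cell addnC ltn_add2r.
by rewrite leq_mul2r cardE index_mem mem_enum inE orbT.
Qed.

Lemma cell_div v : in_blocks v -> (v %/ 4 = cell (blk v) (v %/ 4 %% J))%N.
Proof.
have J_gt0 : (0 < J)%N by lia.
move=> vB; rewrite /cell /blk index_uniq ?enum_uniq -?divn_eq //.
by rewrite -cardE ltn_divLR.
Qed.

Lemma attachedE w b j r : (j < J)%N -> (r < 4)%N ->
  attached w (4 * cell b j + r) =
  if r == 0%N then j != 0%N else (j == 0%N) || (r == 1%N) && w b j.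
Proof.
move=> jJ r4; rewrite /attached blk_cell // /in_blocks.
rewrite (_ : (4 * cell b j + r) %/ 4 = cell b j)%N; last by lia.
rewrite (_ : (4 * cell b j + r) %% 4 = r)%N; last by lia.
by rewrite cell_mod // cell_lt.
Qed.

Lemma blk_parent w y : attached w y -> blk (parent y) = blk y.
Proof.
rewrite /attached /parent /blk => /andP[_]; case: ifP => [y4|y4 _]; last first.
  by congr (nth _ _ (_ %/ _)); lia.
set c := (y %/ 4)%N; rewrite (_ : (y - 4) %/ 4 = c.-1)%N; last by lia.
have J_gt0 : (0 < J)%N by lia.
by case: c => [|c] //= cJ; rewrite divnS // /dvdn (negbTE cJ).
Qed.

Lemma in_blocks_parent w y : attached w y -> in_blocks (parent y).
Proof.
by move=> yA; move: (parent_lt yA); move: yA => /andP[+ _]; rewrite /in_blocks; lia.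
Qed.

Lemma adj_blk w x y : adj w x y -> blk x = blk y.
Proof. by case/orP => /andP[/blk_parent yx /eqP <-]; rewrite yx. Qed.

Lemma adj_in_blocks w x y : adj w x y -> in_blocks x.
Proof.
case/orP => /andP[A_attached]; last by case/andP: A_attached.
by move=> /eqP <-; apply: in_blocks_parent A_attached.
Qed.

Lemma attached_local w w' y : w (blk y) =1 w' (blk y) -> attached w y = attached w' y.
Proof. by move=> ww'; rewrite /attached ww'. Qed.

(** Edges stay inside a block, so a query at [x] reveals nothing about the patterns of other
    blocks. *)
Lemma adj_local w w' x y : w (blk x) =1 w' (blk x) -> adj w x y = adj w' x y.
Proof.
move=> ww'; rewrite /adj (attached_local ww').
suff H w1 w2 : w1 (blk x) =1 w2 (blk x) ->
    attached w1 y && (parent y == x) -> attached w2 y && (parent y == x).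
  by congr (_ || _); apply/idP/idP; apply: H => // z; rewrite ww'.
move=> w12 /andP[yA /eqP yx]; rewrite yx eqxx andbT.
by rewrite (attached_local (w' := w1)) // -(blk_parent yA) yx => z; rewrite w12.
Qed.

Lemma block_graph_simple n w : simple_graph (@block_graph n w).
Proof.
split=> [u v|u]; first exact: adjC.
by apply/negP => /orP[] /andP[/parent_lt + /eqP uu]; rewrite uu ltnn.
Qed.

Lemma adj_parent w x y : adj w x y -> (x < y)%N -> x = parent y.
Proof.
case/orP => /andP[+ /eqP <-] //; move=> /parent_lt; lia.
Qed.

Lemma block_graph_forest n w : forest (@block_graph n w).
Proof.
apply: (@forest_of_unique_smaller_neighbor _ _ parent); first exact: block_graph_simple.
by move=> u v; apply: adj_parent.
Qed.

Lemma adj_near w x y : adj w x y -> (x <= y + 4)%N && (y <= x + 4)%N.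
Proof.
by case/orP => /andP[_ /eqP <-]; rewrite /parent; case: ifP => _; lia.
Qed.

Lemma block_graph_max_degree n w : (max_degree (@block_graph n w) <= 9)%N.
Proof.
apply/bigmax_leqP => u _; rewrite cardE -(size_map (@nat_of_ord n)).
apply: (@leq_trans (size (iota (u - 4) 9))); last by rewrite size_iota.
apply: uniq_leq_size; first by rewrite map_inj_uniq ?enum_uniq //; apply: val_inj.
move=> _ /mapP[v + ->]; rewrite mem_enum inE mem_iota => /adj_near; lia.
Qed.

(** * Block, cell and position as coordinates of a vertex *)

Definition vertex (b : B) j r : nat := (4 * cell b j + r)%N.

Lemma vertexP v : in_blocks v ->
  exists b j r, [/\ (j < J)%N, (r < 4)%N & v = vertex b j r].
Proof.
have J_gt0 : (0 < J)%N by lia.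
move=> vB; exists (blk v), (v %/ 4 %% J)%N, (v %% 4)%N.
rewrite ltn_mod J_gt0 ltn_mod; split=> //.
by rewrite /vertex -cell_div // mulnC -divn_eq.
Qed.

Lemma vertex_inj b b' j j' r r' : (j < J)%N -> (j' < J)%N -> (r < 4)%N -> (r' < 4)%N ->
  vertex b j r = vertex b' j' r' -> [/\ b = b', j = j' & r = r'].
Proof.
move=> jJ jJ' r4 r4' eq_v.
have rr' : r = r' by move: eq_v; rewrite /vertex; lia.
have eq_c : cell b j = cell b' j' by move: eq_v; rewrite /vertex; lia.
split=> //; first by rewrite -(blk_cell b jJ r4) -(blk_cell b' jJ' r4'); congr blk.
by rewrite -(cell_mod b jJ) eq_c cell_mod.
Qed.

Lemma vertex_lt b j r : (j < J)%N -> (r < 4)%N -> (vertex b j r < 4 * #|B| * J)%N.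
Proof. by move=> jJ r4; rewrite /vertex; have := cell_lt b jJ; lia. Qed.

Lemma parent_vertex b j r : (r < 4)%N ->
  parent (vertex b j r) = if r == 0%N then (vertex b j 0 - 4)%N else vertex b j 0.
Proof. by move=> r4; rewrite /parent /vertex; case: eqP; case: eqP; lia. Qed.

Lemma parent_spine b j : parent (vertex b j.+1 0) = vertex b j 0.
Proof. by rewrite parent_vertex //= /vertex /cell; lia. Qed.

Lemma parent_mod4 v : (parent v %% 4 = 0)%N.
Proof. by rewrite /parent; case: ifP; lia. Qed.

Lemma adj_spine w b j : (j.+1 < J)%N -> adj w (vertex b j 0) (vertex b j.+1 0).
Proof. by move=> jJ; rewrite /adj attachedE //= parent_spine eqxx. Qed.

Lemma adj_leaf w b j r : (j < J)%N -> (0 < r < 4)%N ->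
  (j == 0%N) || (r == 1%N) && w b j -> adj w (vertex b j 0) (vertex b j r).
Proof.
move=> jJ /andP[r0 r4] jr; rewrite /adj attachedE // parent_vertex //.
by rewrite eqn0Ngt r0 /= jr eqxx.
Qed.

Lemma spine_adj w b j y : (j < J)%N -> adj w (vertex b j 0) y ->
  [\/ (0 < j)%N /\ y = vertex b j.-1 0,
      (j.+1 < J)%N /\ y = vertex b j.+1 0 |
      exists r, [/\ (0 < r < 4)%N, y = vertex b j r & (j == 0%N) || (r == 1%N) && w b j]].
Proof.
move=> jJ /orP[/andP[yA /eqP]|/andP[+ /eqP <-]]; last first.
  rewrite attachedE //=; case: j jJ => // j jJ _; constructor 1; split=> //.
  exact: parent_spine.
have [b' [j' [r [jJ' r4 y_def]]]] : exists b j r, [/\ (j < J)%N, (r < 4)%N & y = vertex b j r].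
  by apply: vertexP; case/andP: yA.
move: yA; rewrite y_def attachedE //; case: r r4 {y_def} (y_def) => [|r] r4 y_def /=.
  case: j' jJ' y_def => // j' jJ' y_def _; rewrite parent_spine.
  by case/(vertex_inj (ltnW jJ') jJ) => // <- <- _; constructor 2.
move=> yA; rewrite parent_vertex //= => /(vertex_inj jJ' jJ) [] // bb jj _.
by constructor 3; exists r.+1; rewrite -bb -jj; split.
Qed.

Lemma leaf_adj w b j r y : (j < J)%N -> (0 < r < 4)%N ->
  adj w (vertex b j r) y -> y = vertex b j 0.
Proof.
move=> jJ /andP[r0 r4] /orP[/andP[_ /eqP yE]|/andP[_ /eqP <-]]; last first.
  by rewrite parent_vertex // eqn0Ngt r0.
by have := parent_mod4 y; rewrite yE /vertex; lia.
Qed.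

(** Embeddings are rigid. The root has four neighbors and must go to a root; injectivity then forces
    the spine to follow the spine in order, and a pendant leaf needs a third neighbor in the image.
    The end of the spine is exempt because its last vertex could land on a pendant leaf. *)
Lemma embedded_pattern w w' b (iota : nat -> nat) :
  {in [pred x | (x < 4 * #|B| * J)%N] &, injective iota} ->
  (forall x y, blk x = b -> adj w x y -> adj w' (iota x) (iota y)) ->
  exists b', forall j, (0 < j)%N -> (j.+2 < J)%N -> w b j -> w' b' j.
Proof.
move=> iota_inj hom.
have inj j j' r r' : (j < J)%N -> (j' < J)%N -> (r < 4)%N -> (r' < 4)%N ->
    iota (vertex b j r) = iota (vertex b j' r') -> j = j' /\ r = r'.
  move=> jJ jJ' r4 r4' /iota_inj; rewrite !inE !vertex_lt // => /(_ isT isT).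
  by case/vertex_inj.
have spine j : (j.+1 < J)%N -> adj w' (iota (vertex b j 0)) (iota (vertex b j.+1 0)).
  by move=> jJ; apply: hom (adj_spine _ _ jJ); rewrite blk_cell // ltnW.
have spine' j : (j.+1 < J)%N -> adj w' (iota (vertex b j.+1 0)) (iota (vertex b j 0)).
  by move=> jJ; rewrite adjC spine.
have leaf j r : (j < J)%N -> (0 < r < 4)%N -> (j == 0%N) || (r == 1%N) && w b j ->
    adj w' (iota (vertex b j 0)) (iota (vertex b j r)).
  by move=> jJ r4 jr; apply: hom (adj_leaf _ _ _) => //; rewrite blk_cell.
have J_gt0 : (0 < J)%N by lia.
have J_gt1 : (1 < J)%N by lia.
have [b' root] : exists b', iota (vertex b 0 0) = vertex b' 0 0.
  have := vertexP (adj_in_blocks (spine 0%N J_gt1)).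
  move=> [b' [j' [r' [jJ' r4' xE]]]]; exists b'.
  have y0 := spine 0%N J_gt1.
  have y1 := leaf 0%N 1%N J_gt0 isT isT.
  have y2 := leaf 0%N 2%N J_gt0 isT isT.
  have y3 := leaf 0%N 3%N J_gt0 isT isT.
  have n01 : iota (vertex b 1 0) <> iota (vertex b 0 1) by case/inj.
  have n02 : iota (vertex b 1 0) <> iota (vertex b 0 2) by case/inj.
  have n03 : iota (vertex b 1 0) <> iota (vertex b 0 3) by case/inj.
  have n12 : iota (vertex b 0 1) <> iota (vertex b 0 2) by case/inj.
  have n13 : iota (vertex b 0 1) <> iota (vertex b 0 3) by case/inj.
  have n23 : iota (vertex b 0 2) <> iota (vertex b 0 3) by case/inj.
  rewrite xE in y0 y1 y2 y3.
  (* A leaf has a single neighbor, which cannot accommodate two distinct images. *)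
  have [r0|r0] := posnP r'; last first.
    have rr : (0 < r' < 4)%N by rewrite r0.
    by case: n01; rewrite (leaf_adj jJ' rr y0) (leaf_adj jJ' rr y1).
  subst r'; have [j0|j0] := posnP j'; first by rewrite xE j0.
  (* A spine vertex other than a root has at most three neighbors, too few for four distinct
     images. *)
  have nbr y : adj w' (vertex b' j' 0) y ->
      [\/ y = vertex b' j'.-1 0, y = vertex b' j'.+1 0 | y = vertex b' j' 1].
    case/(spine_adj jJ') => [[_ ->]|[_ ->]|[r [_ ->]]]; rewrite ?(gtn_eqF j0) /=.
    - by constructor 1.
    - by constructor 2.
    - by move=> /andP[/eqP -> _]; constructor 3.
  by case: (nbr _ y0) => e0; case: (nbr _ y1) => e1; case: (nbr _ y2) => e2;
    case: (nbr _ y3) => e3; congruence.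
exists b'.
(* Two consecutive vertices are tracked so that injectivity excludes a step back. The spine vertex
   at [j.+2] shows that the image of the one at [j.+1] is not a leaf. *)
have follow j : (j.+2 < J)%N ->
    iota (vertex b j 0) = vertex b' j 0 /\ iota (vertex b j.+1 0) = vertex b' j.+1 0.
  elim: j => [|j IH] jJ.
    split=> //; have := spine 0%N J_gt1; rewrite root => /spine_adj [] // [] //.
    move=> r [r4 yE _]; have := spine 1%N jJ; rewrite yE.
    by move=> /(leaf_adj J_gt0 r4); rewrite -root => /inj [].
  have [e0 e1] := IH (ltnW jJ); split=> //.
  have := spine j.+1 (ltnW jJ); rewrite e1 => /spine_adj []; first by lia.
  - by move=> [_ /=]; rewrite -e0 => /inj [] //; lia.
  - by move=> [].
  - move=> [r [r4 yE _]]; have := spine j.+2 jJ; rewrite yE.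
    by move=> /(leaf_adj (ltnW (ltnW jJ)) r4); rewrite -e1 => /inj []; lia.
move=> j j0 jJ wj; have [xE _] := follow j jJ.
have jJ' : (j < J)%N by lia.
(* Without a pendant leaf the image vertex has at most two neighbors, but the two spine neighbors
   and the leaf have three distinct images. *)
apply: contraT => w'j.
have nbr y : adj w' (vertex b' j 0) y -> y = vertex b' j.-1 0 \/ y = vertex b' j.+1 0.
  case/(spine_adj jJ') => [[_ ->]|[_ ->]|[r [_ ->]]]; [by left | by right |].
  by rewrite (gtn_eqF j0) (negbTE w'j) andbF.
have y0 : adj w' (iota (vertex b j 0)) (iota (vertex b j.-1 0)).
  by have := spine' j.-1; rewrite prednK //; apply.
have y1 := spine j (ltnW jJ).
have y2 : adj w' (iota (vertex b j 0)) (iota (vertex b j 1)) by apply: leaf; rewrite ?wj ?orbT.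
have n01 : iota (vertex b j.-1 0) <> iota (vertex b j.+1 0) by case/inj; lia.
have n02 : iota (vertex b j.-1 0) <> iota (vertex b j 1) by case/inj => //; lia.
have n12 : iota (vertex b j.+1 0) <> iota (vertex b j 1) by case/inj => //; lia.
rewrite xE in y0 y1 y2.
by case: (nbr _ y0) => e0; case: (nbr _ y1) => e1; case: (nbr _ y2) => e2; congruence.
Qed.

(** * Isomorphisms permuting whole blocks *)

Lemma shift_subproof n (p : {perm B}) (u : 'I_n) : (4 * #|B| * J <= n)%N ->
  ((if in_blocks u then vertex (p (blk u)) (u %/ 4 %% J) (u %% 4) else u) < n)%N.
Proof.
move=> nB; case: ifP => // _; apply: leq_trans nB.
by rewrite vertex_lt ?ltn_mod //; lia.
Qed.

Definition shift n (nB : (4 * #|B| * J <= n)%N) (p : {perm B}) (u : 'I_n) : 'I_n :=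
  Ordinal (shift_subproof p u nB).

Lemma shift_vertex n (nB : (4 * #|B| * J <= n)%N) p (u : 'I_n) b j r :
  (j < J)%N -> (r < 4)%N -> u = vertex b j r :> nat -> shift nB p u = vertex (p b) j r :> nat.
Proof.
move=> jJ r4 uE /=; have uB : in_blocks u.
  by have := cell_lt b jJ; rewrite uE /in_blocks /vertex; lia.
rewrite uB uE blk_cell //; congr vertex; last by rewrite /vertex; lia.
rewrite (_ : (vertex b j r %/ 4)%N = cell b j) ?cell_mod //.
by rewrite /vertex; lia.
Qed.

Lemma shiftK n (nB : (4 * #|B| * J <= n)%N) p : cancel (@shift n nB p) (@shift n nB p^-1%g).
Proof.
move=> u; apply: ord_inj; have [uB|uB] := boolP (in_blocks u); last first.
  have uE : shift nB p u = u by apply: val_inj; rewrite /= (negbTE uB).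
  by rewrite uE /= (negbTE uB).
have [b [j [r [jJ r4 uE]]]] := vertexP uB.
by rewrite (shift_vertex nB _ jJ r4 (shift_vertex nB p jJ r4 uE)) permK uE.
Qed.

Lemma attached_shift n (nB : (4 * #|B| * J <= n)%N) (p : {perm B}) w (u v : 'I_n) :
  attached (fun b => w (p b)) v && (parent v == u) ->
  attached w (shift nB p v) && (parent (shift nB p v) == shift nB p u).
Proof.
case/andP => vA /eqP vu; have vB : in_blocks v by case/andP: vA.
have [b [j [r [jJ r4 vE]]]] := vertexP vB.
move: vA vu; rewrite (shift_vertex nB p jJ r4 vE) vE !attachedE //.
move su : (nat_of_ord (shift nB p u)) => x.
case: r r4 {vE} => [|r] r4 /=.
  case: j jJ => // j jJ _; rewrite !parent_spine => /esym uE.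
  by rewrite -su (shift_vertex nB p (ltnW jJ) _ uE) ?eqxx.
move=> ->; rewrite !parent_vertex //= => /esym uE.
by rewrite -su (shift_vertex nB p jJ _ uE) // eqxx.
Qed.

Lemma block_graph_permuted n (p : {perm B}) w : (4 * #|B| * J <= n)%N ->
  isomorphic (@block_graph n (fun b => w (p b))) (block_graph w).
Proof.
move=> nB; exists (perm (can_inj (shiftK nB p))) => u v; rewrite /relabel !permE.
apply/idP/idP => /orP[] H; apply/orP; [left | right | left | right].
- exact: attached_shift.
- exact: attached_shift.
- rewrite -(shiftK nB p u) -(shiftK nB p v); apply: attached_shift.
  by rewrite (attached_local (w' := w)) // => i; rewrite permKV.
- rewrite -(shiftK nB p u) -(shiftK nB p v); apply: attached_shift.
  by rewrite (attached_local (w' := w)) // => i; rewrite permKV.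
Qed.

(** * Edits forced by patterns that embed nowhere *)

Definition pattern_embeds w w' (b b' : B) : Prop :=
  forall j, (0 < j)%N -> (j.+2 < J)%N -> w b j -> w' b' j.

(** Otherwise the inverse of [s] would send every edge of block [b] to an edge for [w'], and
    [embedded_pattern] would apply. *)
Lemma broken_edge n w w' (s : {perm 'I_n}) b : (4 * #|B| * J <= n)%N ->
  (forall b', ~ pattern_embeds w w' b b') ->
  exists u v : 'I_n, [/\ blk u = b, adj w u v &
    ~~ block_graph w' ((s^-1)%g u) ((s^-1)%g v)].
Proof.
move=> nB no_embedding; apply: contrapT => no_broken.
(* The default 0 is taken only from [n] on, hence outside the blocks. *)
pose iota x : nat := oapp (fun u : 'I_n => nat_of_ord ((s^-1)%g u)) 0%N (insub x).
have iotaE (u : 'I_n) : iota u = (s^-1)%g u by rewrite /iota valK.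
have in_n x : in_blocks x -> (x < n)%N.
  by rewrite /in_blocks => xB; apply: leq_trans nB; lia.
have [b' H] : exists b', pattern_embeds w w' b b'.
  apply: (@embedded_pattern w w' b iota) => [x y|x y xb xy].
    rewrite !inE => xn yn.
    have := iotaE (Ordinal (leq_trans xn nB)); have := iotaE (Ordinal (leq_trans yn nB)).
    by move=> /= -> -> /val_inj /perm_inj [].
  have xn := in_n _ (adj_in_blocks xy); rewrite adjC in xy.
  have yn := in_n _ (adj_in_blocks xy); rewrite adjC in xy.
  have := iotaE (Ordinal xn); have := iotaE (Ordinal yn) => /= -> ->.
  apply: contraT => broken; case: no_broken.
  by exists (Ordinal xn), (Ordinal yn).
exact: no_embedding H.
Qed.

(** Each block of [X] has a broken edge, which must be added to the graph of [w']. Edges from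
    different blocks are distinct because an endpoint determines its block. *)
Lemma edits_lower n w w' (s : {perm 'I_n}) (X : {set B}) : (4 * #|B| * J <= n)%N ->
  (forall b b', b \in X -> ~ pattern_embeds w w' b b') ->
  (#|X| <= edits (@block_graph n w') (relabel s (block_graph w)))%N.
Proof.
move=> nB no_embedding.
have /boolp.choice [broken brokenP] : forall b, exists p : 'I_n * 'I_n, b \in X ->
    [/\ blk p.1 = b, adj w p.1 p.2 &
      ~~ block_graph w' ((s^-1)%g p.1) ((s^-1)%g p.2)].
  move=> b.
  have [bX|bX] := boolP (b \in X).
    have [u [v uv]] := broken_edge s nB (fun b' => @no_embedding b b' bX).
    by exists (u, v).
  have [n0|n0] := posnP n; last by exists (Ordinal n0, Ordinal n0).
  have : (0 < #|B|)%N by apply/card_gt0P; exists b.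
  move=> B_gt0; have : (0 < 4 * #|B| * J)%N.
    by rewrite !muln_gt0 B_gt0 (ltn_trans _ J_gt2).
  by move: nB; lia.
pose edge b := [set (s^-1)%g (broken b).1; (s^-1)%g (broken b).2].
have edge_inj : {in X &, injective edge}.
  move=> b c bX cX bc; have [b_blk b_adj _] := brokenP b bX.
  have [c_blk c_adj _] := brokenP c cX.
  have : (s^-1)%g (broken b).1 \in edge c by rewrite -bc !inE eqxx.
  rewrite !inE => /orP[/eqP/perm_inj E|/eqP/perm_inj E].
    by rewrite -b_blk -c_blk E.
  by rewrite -b_blk -c_blk E (adj_blk c_adj).
rewrite -(card_in_imset edge_inj); apply: leq_trans (leq_addl _ _).
apply: subset_leq_card; apply/fintype.subsetP => _ /imsetP[b bX ->].
have [b_blk b_adj b_broken] := brokenP b bX.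
rewrite inE; apply/andP; split; last first.
  apply/imsetP; exists ((s^-1)%g (broken b).1, (s^-1)%g (broken b).2) => //.
  by rewrite inE /relabel /= !permKV.
apply: contra b_broken => /imsetP[[u v] /=]; rewrite inE /= => uv edge_uv.
have [w'_sym w'_irr] := block_graph_simple n w'.
set x := (s^-1)%g (broken b).1 in edge_uv *; set y := (s^-1)%g (broken b).2 in edge_uv *.
have xy : x != y.
  apply/eqP => /perm_inj E; have [_ /(_ (broken b).1)] := block_graph_simple n w.
  by rewrite /block_graph {2}E b_adj.
have : x \in [set u; v] by rewrite -edge_uv !inE eqxx.
have : y \in [set u; v] by rewrite -edge_uv !inE eqxx orbT.
rewrite !inE => /orP[] /eqP yE /orP[] /eqP xE; move: xy; rewrite ?xE ?yE ?eqxx //.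
by rewrite w'_sym.
Qed.

End BlockForests.

(** * The two input distributions *)

Section Families.

Variables (B T : finType).

(** Independent uniform permutations of types and blocks induce the uniform distribution on this
    orbit, so probabilities over inputs become ratios of cardinalities. *)
Definition orbit_family (phi : B -> T) : {set {ffun B -> T}} :=
  [set [ffun b => sp.1 (phi (sp.2 b))] | sp : {perm T} * {perm B}].

Lemma orbit_family_exchangeable phi : exchangeable (orbit_family phi).
Proof.
move=> s p _ /imsetP[[s' p'] _ ->]; apply/imsetP; exists ((s' * s)%g, (p * p')%g) => //.
by apply/ffunP => b; rewrite !ffunE /= !permM.
Qed.

Lemma orbit_family_gt0 phi : (0 < #|orbit_family phi|)%N.
Proof.
by apply/card_gt0P; eexists; apply/imsetP; exists (1%g, 1%g).
Qed.

Lemma orbit_family_fibers phi k : (forall a, (#|[set b | phi b == a]| <= k)%N) ->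
  fibers_bounded k (orbit_family phi).
Proof.
move=> phi_k _ /imsetP[[s p] _ ->] a; apply: leq_trans (phi_k ((s^-1)%g a)).
rewrite -(card_imset _ (@perm_inj _ p)); apply: subset_leq_card.
apply/fintype.subsetP => _ /imsetP[b + ->]; rewrite !inE ffunE /= => /eqP <-.
by rewrite permK.
Qed.

End Families.

(** * Tree types and the forests built from them *)

Section TreeTypes.

Variables l m : nat.

Definition tree_type : finType := (bool * l.-tuple bool)%type.

Definition slot : finType := (tree_type * 'I_m)%type.

(* Bit number i is encoded by a pendant leaf at spine vertex 2i + 1 or 2i + 2,
   so that distinct types give incomparable patterns. *)
Definition pendant (x : tree_type) (j : nat) : bool :=
  let bits := x.1 :: x.2 in
  if odd j then nth false bits j./2 else ~~ nth false bits j./2.-1.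

(** The [l.+1] bits occupy positions 1 to 2l + 2. The root precedes them and two more spine vertices
    follow, so that [j.+2 < spine_length] holds at each of these positions. *)
Definition spine_length : nat := (2 * l + 5)%N.

(** Types with first bit [true] never occur, the others occur twice as often as under the first
    projection. *)
Definition half_slot (b : slot) : tree_type := (false, b.1.2).

(** The odd position of a bit yields one implication between the bits of [x] and [y]; the even
    position, which carries the negated bit, yields the converse. *)
Lemma pendant_antichain x y :
  (forall j, (0 < j)%N -> (j.+2 < spine_length)%N -> pendant x j -> pendant y j) -> x = y.
Proof.
move=> xy; have bits_eq : x.1 :: tval x.2 = y.1 :: tval y.2.
  apply: (@eq_from_nth _ false) => [|i]; first by rewrite /= !size_tuple.
  rewrite /= size_tuple => il.
  have := xy i.*2.+1 isT; have := xy i.*2.+2 isT.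
  rewrite /pendant /= odd_double /= doubleK uphalf_double.
  have -> : (i.*2.+4 < spine_length)%N by rewrite /spine_length; lia.
  have -> : (i.*2.+3 < spine_length)%N by rewrite /spine_length; lia.
  move=> /(_ isT) nxy /(_ isT) xy1; apply/idP/idP; first exact: xy1.
  by apply: contraLR; apply: nxy.
case: x y bits_eq {xy} => [x1 x2] [y1 y2] /= [-> x2y2].
by congr pair; apply: val_inj.
Qed.

Lemma card_tree_type : #|tree_type| = (2 ^ l.+1)%N.
Proof. by rewrite card_prod card_bool card_tuple card_bool expnS. Qed.

Lemma card_slot : #|slot| = (2 ^ l.+1 * m)%N.
Proof. by rewrite card_prod card_tree_type card_ord. Qed.

Lemma fst_fibers a : (#|[set b : slot | b.1 == a]| <= 2 * m)%N.
Proof.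
rewrite (_ : [set b : slot | b.1 == a] = finset.setX [set a] [set: 'I_m]).
  by rewrite cardsX cards1 cardsT card_ord; lia.
by apply/setP => -[x i]; rewrite !inE andbT.
Qed.

Lemma half_slot_fibers a : (#|[set b | half_slot b == a]| <= 2 * m)%N.
Proof.
apply: (@leq_trans #|finset.setX [set (true, a.2); (false, a.2)] [set: 'I_m]|).
  apply: subset_leq_card; apply/fintype.subsetP => -[[[] x] i]; rewrite !inE andbT;
    move=> /eqP <- /=; by rewrite eqxx ?orbT.
by rewrite cardsX cardsT card_ord leq_mul2r cards2 ltnS leq_b1 orbT.
Qed.

(** The images under [s] of the types with first bit [true] are never taken; there are [2 ^ l] of
    them, with [m] slots each. *)
Lemma missing_slots f : f \in orbit_family half_slot ->
  (2 ^ l * m <= #|[set b : slot | [forall b', f b' != b.1]]|)%N.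
Proof.
move=> /imsetP[[s p] _ ->].
pose W : {set tree_type} := s @: finset.setX [set true] [set: l.-tuple bool].
have <- : #|finset.setX W [set: 'I_m]| = (2 ^ l * m)%N.
  rewrite cardsX cardsT card_ord card_imset; last exact: perm_inj.
  by rewrite cardsX cards1 cardsT card_tuple card_bool mul1n.
apply: subset_leq_card; apply/fintype.subsetP => -[x i]; rewrite !inE andbT /=.
move=> /imsetP[[y1 y2]]; rewrite !inE andbT /= => /eqP -> ->.
by apply/forallP => b; rewrite ffunE /= (inj_eq perm_inj) xpair_eqE.
Qed.

(** A permutation of the types acts on slots while keeping the copy number, so it can be absorbed
    into the permutation of the slots. *)
Lemma full_orbit f : f \in orbit_family (fun b : slot => b.1) ->
  exists p : {perm slot}, forall b, f b = (p b).1.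
Proof.
move=> /imsetP[[s p] _ ->].
have t_inj : injective (fun b : slot => (s b.1, b.2)).
  by move=> [x i] [y j] [/perm_inj -> ->].
by exists (p * perm t_inj)%g => b; rewrite ffunE permM permE.
Qed.

Variables (b0 : slot) (n : nat).
Implicit Types f : {ffun slot -> tree_type}.

Definition type_graph f : rel 'I_n :=
  @block_graph spine_length slot b0 n (fun b => pendant (f b)).

Definition type_lists f (v : 'I_n) : seq 'I_n := [seq u <- enum 'I_n | type_graph f v u].

Definition all_types_forest : rel 'I_n :=
  @block_graph spine_length slot b0 n (fun b => pendant b.1).

Lemma spine_length_gt2 : (2 < spine_length)%N.
Proof. by rewrite /spine_length; lia. Qed.

Lemma type_input f : is_input 9 (type_graph f) (type_lists f).
Proof.
split; [exact: (block_graph_simple b0 spine_length_gt2) | |].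
  exact: (block_graph_max_degree b0 spine_length_gt2).
move=> v; split; first by rewrite filter_uniq ?enum_uniq.
by move=> u; rewrite mem_filter mem_enum !inE andbT.
Qed.

Lemma type_lists_local (v : 'I_n) f f' :
  f (blk spine_length b0 v) = f' (blk spine_length b0 v) -> type_lists f v = type_lists f' v.
Proof.
move=> ff'; apply: eq_filter => u; apply: adj_local; first exact: spine_length_gt2.
by rewrite ff'.
Qed.

Lemma full_type_graph_isomorphic f : (4 * #|slot| * spine_length <= n)%N ->
  f \in orbit_family (fun b : slot => b.1) -> isomorphic (type_graph f) all_types_forest.
Proof.
move=> n_large /full_orbit[p fE].
rewrite (_ : type_graph f = block_graph spine_length b0 (fun b => pendant (p b).1)).
  exact: (block_graph_permuted b0 spine_length_gt2 p (fun b : slot => pendant b.1) n_large).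
by congr block_graph; apply/funext => b; rewrite fE.
Qed.

(** By the antichain property, the tree of a slot whose type is missing from [f] could embed only in
    a block of that same type. *)
Lemma half_type_graph_edits f (s : {perm 'I_n}) :
  (4 * #|slot| * spine_length <= n)%N -> f \in orbit_family half_slot ->
  (2 ^ l * m <= edits (type_graph f) (relabel s all_types_forest))%N.
Proof.
move=> n_large fZ; apply: leq_trans (missing_slots fZ) _.
apply: edits_lower => //; first exact: spine_length_gt2.
move=> b b'; rewrite inE => /forallP /(_ b') /eqP fb H; apply: fb.
by apply/esym/pendant_antichain.
Qed.

Lemma half_type_graph_far (R : realType) (eps : R) f :
  (0 < n)%N -> (4 * #|slot| * spine_length <= n)%N ->
  f \in orbit_family half_slot -> eps * (9 * n)%:R < (2 ^ l * m)%:R ->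
  far 9 eps (type_graph f) all_types_forest.
Proof.
move=> n_gt0 n_large fZ eps_lt; rewrite /far /distance ltr_pdivlMr; last first.
  by rewrite mulr_gt0 ?ltr0n.
rewrite -natrM; apply: lt_le_trans eps_lt _; rewrite ler_nat.
exact: half_type_graph_edits.
Qed.

End TreeTypes.

Lemma bernoulli_le (R : realDomainType) (e : R) q :
  0 <= e -> e <= 1 -> 1 - e *+ q <= (1 - e) ^+ q.
Proof.
move=> e0 e1; elim: q => [|q IH]; first by rewrite mulr0n subr0 expr0.
have e1' : 0 <= 1 - e by lra.
rewrite exprS; apply: le_trans (ler_wpM2l e1' IH); rewrite mulrS.
have : 0 <= e * (e *+ q) by rewrite mulr_ge0 // mulrn_wge0.
move: (e *+ q) => x; lra.
Qed.

(** * Query lower bound *)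

(** With N = 2^(l+1), at most [q] queries on every input would make the two error rates add up to at
    least (1 - e)^q >= 1 - 4 q^2 / N > 2/3, whereas those of a tester add up to at most 2/3. *)
Lemma many_queries (R : realType) (l m n q : nat) (b0 : slot l m) (eps : R)
    (disp : measure_display) (Omega : measurableType disp) (P : probability Omega R)
    (A : Omega -> query_algorithm n 9) :
  (0 < m)%N -> (4 * #|slot l m| * spine_length l <= n)%N ->
  (12 * q ^ 2 < 2 ^ l.+1)%N -> eps * (9 * n)%:R < (2 ^ l * m)%:R ->
  property_tester (@all_types_forest l m b0 n) eps P A ->
  exists (g : rel 'I_n) (L : 'I_n -> seq 'I_n) (w : Omega),
    is_input 9 g L /\ (q < queries L (A w))%N.
Proof.
move=> m_gt0 n_large q_small eps_small tester; apply: contrapT => no_input.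
pose Y := orbit_family (fun b : slot l m => b.1).
pose Z := orbit_family (@half_slot l m).
pose L (f : {ffun slot l m -> tree_type l}) := @type_lists l m b0 n f.
have few_queries f w : (queries (L f) (A w) <= q)%N.
  rewrite leqNgt; apply/negP => many; apply: no_input.
  by exists (@type_graph l m b0 n f), (L f), w; split=> //; apply: type_input.
pose N : R := (2 ^ l.+1)%:R.
have N_gt0 : 0 < N by rewrite ltr0n expn_gt0.
have q_small' : 12 * q%:R ^+ 2 < N.
  by rewrite -natrX -natrM ltr_nat.
have q_le_sq : q%:R <= q%:R ^+ 2 :> R.
  by rewrite -natrX ler_nat expnS expn1; case: (q) => // k; rewrite leq_pmulr.
(* Fibers of size up to [2 * m] call for about 2 q / N; the factor 4 leaves room for the [q] slots
   subtracted in [collisions]. *)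
pose e : R := 4 * q%:R / N.
have eN : e * N = 4 * q%:R by rewrite /e mulfVK // gt_eqF.
have q_ge0 : 0 <= q%:R :> R by [].
have e_ge0 : 0 <= e by apply: divr_ge0; [lra | exact: ltW].
have e_lt1 : e < 1 by rewrite /e ltr_pdivrMr // mul1r; lra.
have q_lt_T : (q < 2 ^ l.+1)%N.
  by rewrite -(ltr_nat R) -/N; lra.
have q_lt_slot : (q < #|slot l m|)%N.
  by rewrite card_slot; apply: leq_trans q_lt_T _; rewrite leq_pmulr.
have collisions : (q * (2 * m))%:R <= e * (#|slot l m| - q)%:R.
  rewrite (natrB _ (ltnW q_lt_slot)) card_slot !natrM -/N.
  have m1 : 1 <= m%:R :> R by rewrite ler1n.
  have : e * q%:R <= q%:R * m%:R.
    apply: (@le_trans _ _ q%:R); first by rewrite ler_piMl // ltW.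
    by rewrite ler_peMr.
  rewrite mulrBr (mulrA e) eN; have : 0 <= q%:R * m%:R :> R by rewrite mulr_ge0.
  lra.
have n_gt0 : (0 < n)%N.
  apply: leq_trans n_large; rewrite !muln_gt0 card_slot muln_gt0 expn_gt0 m_gt0 /=.
  by rewrite /spine_length; lia.
have : (1 - e) ^+ q <= 2 / 3.
  apply: (@average_error_le R disp Omega P _ (fun w f => accepts (L f) (A w)) Y Z).
  - by rewrite exprn_ge0 // subr_ge0 ltW.
  - exact: orbit_family_gt0.
  - exact: orbit_family_gt0.
  - by move=> f; case: (tester _ _ (@type_input l m b0 n f)).
  - move=> f fY; case: (tester _ _ (@type_input l m b0 n f)) => _ + _; apply.
    exact: full_type_graph_isomorphic.
  - move=> f fZ; case: (tester _ _ (@type_input l m b0 n f)) => _ _; apply.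
    exact: half_type_graph_far.
  - move=> w.
    have := @error_lower (slot l m) (tree_type l) n 9 L (blk (spine_length l) b0)
      (@type_lists_local l m b0 n) Y Z (2 * m) q R e.
    move=> /(_ (@orbit_family_exchangeable _ _ _) (@orbit_family_exchangeable _ _ _)
      (@orbit_family_fibers _ _ _ _ (@fst_fibers l m))
      (@orbit_family_fibers _ _ _ _ (@half_slot_fibers l m))
      (orbit_family_gt0 _) (orbit_family_gt0 _) q_lt_slot).
    rewrite card_tree_type => /(_ q_lt_T e_ge0 e_lt1 collisions (A w) [::] isT isT isT).
    rewrite ffactn0 divr1 => lower; apply: le_trans (lower _) _.
      by move=> f _; rewrite addn0.
    by rewrite /error !extensions_nil.
have := bernoulli_le q e_ge0 (ltW e_lt1); rewrite -mulr_natr.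
have : e * q%:R * 3 < 1.
  rewrite /e -mulrA mulrAC ltr_pdivrMr // mul1r.
  by have -> : 4 * q%:R * (q%:R * 3) = 12 * q%:R ^+ 2 :> R by ring.
lra.
Qed.

(** * Numerical estimates and choice of parameters *)

Lemma expR_le_pow2 (R : realType) (x : R) k : x <= k%:R / 2 -> expR x <= (2 ^ k)%:R.
Proof.
move=> xk; apply: (@le_trans _ _ (expR (k%:R * 2^-1))); first by rewrite ler_expR.
rewrite expRM_natl natrX lerXn2r ?nnegrE ?expR_ge0 //.
(* It remains to see that exp(1/2) <= 2, which is the inverse of 1 - 1/2 <= exp(-1/2). *)
have := expR_ge1Dx (- 2^-1 : R); rewrite expRN => half_le.
by rewrite -[leLHS]invrK -[leRHS]invrK lef_pV2 ?posrE ?invr_gt0 ?expR_gt0 //; lra.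
Qed.

(** The chain is 12 q^2 <= 12 exp(z/4) < exp(z/2) <= 2^(l+1), where 48 < z ensures exp(z/4) > 12. *)
Lemma query_count_small (R : realType) (z : R) (l : nat) :
  48 < z -> z < l.+1%:R ->
  (12 * Num.truncn (expR (z / 8))%R ^ 2 < 2 ^ l.+1)%N.
Proof.
move=> z_large zl; rewrite -(ltr_nat R).
have /andP[q_le _] := truncn_itv (expR_ge0 (z / 8)).
move: q_le; set q := Num.truncn _ => q_le.
have E2 : expR (z / 8) ^+ 2 = expR (z / 4).
  by rewrite expr2 -expRD; congr expR; lra.
have E1 : 13 <= expR (z / 4) by apply: le_trans (expR_ge1Dx _); lra.
apply: (@lt_le_trans _ _ (expR (z / 4) * expR (z / 4))); last first.
  by rewrite -expRD; apply: expR_le_pow2; lra.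
rewrite natrM natrX; have : q%:R ^+ 2 <= expR (z / 4).
  by rewrite -E2 lerXn2r ?nnegrE ?expR_ge0.
by nra.
Qed.

(** [Q] is the size of one block per type. Rounding gives n < 2 m Q, and what remains is 144 (2 l +
    5) <= 1/eps: the choice of 576 bounds 288 l by half of the right side, and the other half
    exceeds 720. *)
Lemma vertex_count_small (R : realType) (eps : R) (l n : nat) :
  let Q := (4 * 2 ^ l.+1 * spine_length l)%N in
  0 < eps -> 48 < eps^-1 / 576 -> l%:R <= eps^-1 / 576 -> (Q <= n)%N ->
  eps * (9 * n)%:R < (2 ^ l * (n %/ Q))%:R.
Proof.
move=> Q eps_gt0 z_large lz Qn; set m := (n %/ Q)%N.
have Q_gt0 : (0 < Q)%N by rewrite !muln_gt0 expn_gt0 /spine_length; lia.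
have m_gt0 : (0 < m)%N by rewrite divn_gt0.
have n_lt : (n < 2 * m * Q)%N.
  by apply: leq_trans (ltn_ceil n Q_gt0) _; rewrite leq_mul2r; apply/orP; right; lia.
rewrite -ltr_pdivlMl //.
apply: (@lt_le_trans _ _ (9 * (2 * m * Q)%:R)).
  by rewrite natrM ltr_pM2l ?ltr_nat // ltr0n.
have -> : (2 * m * Q = 16 * spine_length l * (2 ^ l * m))%N.
  by rewrite /Q expnS; ring.
rewrite natrM mulrA ler_wpM2r // natrM /spine_length natrD natrM.
by lra.
Qed.

Theorem theorem1p4 (R : realType) :
  exists (c : R) (d : nat), 0 < c /\
  exists eps0 : R, 0 < eps0 /\
  forall eps : R, 0 < eps -> eps < eps0 ->
  exists n0 : nat, forall n : nat, (n0 <= n)%N ->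
  exists h : rel 'I_n, [/\ forest h, (max_degree h <= d)%N &
    forall (disp : measure_display) (Omega : measurableType disp)
      (P : probability Omega R) (A : Omega -> query_algorithm n d),
      property_tester h eps P A ->
      exists (g : rel 'I_n) (L : 'I_n -> seq 'I_n) (w : Omega),
        is_input d g L /\ expR (c * eps^-1) <= (queries L (A w))%:R].
Proof.
(* With z = 1/(576 eps) the query bound is exp(z/8), and the bound on [eps] makes z exceed 48. *)
exists (8 * 576)^-1, 9%N; split; first by rewrite invr_gt0; lra.
exists (48 * 576)^-1; split; first by rewrite invr_gt0; lra.
move=> eps eps_gt0 eps_lt; set z := eps^-1 / 576.
have z_large : 48 < z.
  rewrite ltr_pdivlMr; last by lra.
  by rewrite -[ltLHS]invrK ltf_pV2 ?posrE ?invr_gt0; lra.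
have z_ge0 : 0 <= z by lra.
(* Taking the integer part of [z] keeps the trees of size O(1/eps) while the number of types is at
   least exp(z/2). *)
have /andP[lz zl] := truncn_itv z_ge0; set l := Num.truncn _ in lz zl.
pose Q := (4 * 2 ^ l.+1 * spine_length l)%N; exists Q => n Qn; pose m := (n %/ Q)%N.
have Q_gt0 : (0 < Q)%N by rewrite !muln_gt0 expn_gt0 /spine_length; lia.
have m_gt0 : (0 < m)%N by rewrite divn_gt0.
pose b0 : slot l m := ((false, [tuple of nseq l false]), Ordinal m_gt0).
exists (@all_types_forest l m b0 n); split.
- exact: (block_graph_forest b0 (spine_length_gt2 l)).
- exact: (block_graph_max_degree b0 (spine_length_gt2 l)).
move=> disp Omega P A tester.
have slots_fit : (4 * #|slot l m| * spine_length l <= n)%N.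
  rewrite card_slot (_ : 4 * (2 ^ l.+1 * m) * spine_length l = m * Q)%N ?leq_divM //.
  by rewrite /Q; ring.
have [g [L [w [gL many]]]] := many_queries m_gt0 slots_fit (query_count_small z_large zl)
  (vertex_count_small eps_gt0 z_large lz Qn) tester.
(* Exceeding the integer part of exp(z/8) means making at least exp(z/8) queries. *)
exists g, L, w; split=> //; apply: le_trans (ltW (truncnS_gt _)) _.
rewrite (_ : _ * eps^-1 = z / 8) ?ler_nat //.
by rewrite /z invfM; ring.
Qed.
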